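(* A Banach space $X$ is separable if and only if $X$ has the countable separation property (CSP) and there exist sets $\{x_\alpha\}_\alpha\subset X$ and $\{f_\beta\}_\beta\subset X^*$ such that (a) the norm-closed linear span of $\{x_\alpha\}_\alpha$ is $X$; (b) the $w^*$-closed linear span of $\{f_\beta\}_\beta$ is $X^*$; (c) for each $\beta$, $|\{\alpha : f_\beta(x_\alpha)\neq 0\}|\leq w^*\text{-}\mathrm{dens}(X^* )$. In particular, each Banach space with CSP that admits an M-basis is separable.
   Context: Banach spaces are real; $X^*$ is the dual of $X$ and $w^*$ its weak-star topology. $w^*\text{-}\mathrm{dens}(X^* )$ is the least cardinality of a $w^*$-dense subset of $X^*$. A set $\mathcal{F}\subset X^*$ separates $X$ if for every $x\in X\setminus\{0\}$ there is $f\in\mathcal{F}$ with $f(x)\neq 0$. $X$ has CSP if every separating set $\mathcal{F}\subset X^*$ contains a countable subset that separates $X$. An M-basis (Markushevich basis) of $X$ is a family $\{(x_\alpha,x^*_\alpha)\}_\alpha\subset X\times X^*$ with $x^*_\alpha(x_\beta)=\delta_{\alpha,\beta}$, such that the norm-closed linear span of $\{x_\alpha\}_\alpha$ is $X$ and the $w^*$-closed linear span of $\{x^*_\alpha\}_\alpha$ is $X^*$. *)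

(* Defs.v *)
From HB Require Import structures.
From mathcomp Require Import all_boot all_order all_algebra.
From mathcomp Require Import all_classical all_reals all_analysis.

Set Implicit Arguments.
Unset Strict Implicit.
Unset Printing Implicit Defensive.

Import Order.TTheory GRing.Theory Num.Theory.
Import numFieldNormedType.Exports.

Local Open Scope classical_set_scope.
Local Open Scope ring_scope.
Local Open Scope card_scope.

Section Dual.
Context {R : realType} (X : normedModType R).

Definition dual_pred : {pred X -> R^o} :=
  mem [set f : X -> R^o | linear f /\ continuous f].

Lemma dual_pred_submod : submod_closed dual_pred.
Proof.
split; first by rewrite inE; split=> [a u v /=|u]; rewrite ?scaler0 ?addr0;
  [|exact: cvg_cst].
move=> a f g; rewrite !inE => -[lf cf] [lg cg]; split.
  move=> b u v; rewrite !fctE lf lg !scalerDr !scalerA (mulrC a b).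
  by rewrite addrACA.
by move=> u; apply: cvgD; [apply: cvgZl_tmp; exact: cf|exact: cg].
Qed.

HB.instance Definition _ :=
  GRing.isSubmodClosed.Build R (X -> R^o) dual_pred dual_pred_submod.

(* The dual X^*: continuous linear functionals, with the pointwise vector
   space structure. *)
Record dual := Dual { dual_fun :> X -> R^o ; dual_funP : dual_fun \in dual_pred }.

HB.instance Definition _ := [isSub for dual_fun].
HB.instance Definition _ := [Choice of dual by <:].
HB.instance Definition _ := [SubChoice_isSubLmodule of dual by <:].

(* The canonical topology of [dual] is the w^*-topology, i.e. the topology of
   pointwise convergence on X, and not the one of the dual norm. *)
HB.instance Definition _ := Topological.copy dual
  (initial_topology (dual_fun : dual -> {ptws X -> R})).

End Dual.

Section Span.
Context {K : pzRingType} {V : lmodType K}.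

Definition lin_span (A : set V) : set V :=
  [set v | exists n (c : 'I_n -> K) (a : 'I_n -> V),
    (forall i, A (a i)) /\ v = \sum_(i < n) c i *: a i].

End Span.

Definition separable (T : topologicalType) :=
  exists2 D : set T, countable D & dense D.

(* The cardinality of D is the density character dens(T), i.e. the least
   cardinality of a dense subset of T. *)
Definition realizes_dens (T : topologicalType) (D : set T) :=
  dense D /\ forall E : set T, dense E -> D #<= E.

(* |A| <= dens(T) *)
Definition card_le_dens I (A : set I) (T : topologicalType) :=
  exists2 D : set T, realizes_dens D & A #<= D.

Section CSP.
Context {R : realType} (X : normedModType R).

Definition separates (F : set (dual X)) :=
  forall x : X, x != 0 -> exists2 f, F f & f x != 0.

Definition CSP := forall F : set (dual X), separates F ->
  exists G : set (dual X), [/\ G `<=` F, countable G & separates G].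

Definition M_basis I (x : I -> X) (xs : I -> dual X) :=
  [/\ forall a b, xs a (x b) = `[< a = b >]%:R,
      closure (lin_span (range x)) = [set: X] &
      closure (lin_span (range xs)) = [set: dual X]].

End CSP.

(* Main.v *)
Require Import Defs.
From HB Require Import structures.
From mathcomp Require Import all_boot all_order all_algebra.
From mathcomp Require Import all_classical all_reals all_analysis.
From mathcomp Require Import ring lra.

Set Implicit Arguments.
Unset Strict Implicit.
Unset Printing Implicit Defensive.

Import Order.TTheory GRing.Theory Num.Theory.
Import numFieldNormedType.Exports.

Local Open Scope classical_set_scope.
Local Open Scope ring_scope.

(** Why CSP makes everything countable. By Hahn-Banach the whole dual separates
    X, so CSP yields a countable separating set G in X^*. A linear subspace of
    X^* that separates X interpolates every functional at finitely many points
    ([interpolation]), hence is w*-dense; applied to the span of G, with the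
    coefficients then rounded to rationals, this shows that X^* has a countable
    w*-dense subset. Therefore w*-dens(X^* ) is at most countable, and condition
    (c) says that each f_b is nonzero on only countably many of the x_a.

    Condition (b) makes {f_b} separating ([separates_dense_span], again by
    Hahn-Banach). CSP extracts countably many f_b that still separate; every
    nonzero x_a is detected by one of them, so only countably many x_a are
    nonzero, and by (a) their rational combinations are dense in X
    ([CSP_countable_system_separable]). An M-basis is the case where each f_b is
    nonzero at exactly one x_a.

    Conversely, a separable X has a countable base of balls, so that X minus the
    origin is Lindelof: the open cover by the sets {f <> 0}, f in a separating
    set, has a countable subcover ([separable_CSP]). For the system take a dense
    sequence in X and all of X^*. Here (c) asks for w*-dens(X^* ) to be infinite,
    which fails only if X = 0; the empty family of functionals then works. *)

(** * The Hahn-Banach theorem for the norm *)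

Section HahnBanach.
Context {R : realType} (X : normedModType R).
Implicit Types G L : set (X * R^o).

(** Partial functionals are encoded by their graphs, which avoids functions with
    a varying domain: domination by the norm already forces a linear graph to be
    single-valued, and unions of chains are unions of sets. *)
Definition dominated_graph G :=
  (forall a p q, G p -> G q -> G (a *: p + q)) /\
  (forall p, G p -> p.2 <= `|p.1|).

(** The value c at the new point v must satisfy
    r - |u - v| <= c <= |u + v| - r for all (u, r) in the graph; the triangle
    inequality puts every left-hand side below every right-hand side, so their
    supremum is a valid choice. *)
Lemma dominated_graph_extend G (v : X) : G 0 -> dominated_graph G ->
  exists2 G', dominated_graph G' /\ G `<=` G' & exists c, G' (v, c).
Proof.
move=> G0 [Glin Gdom].
have GZ a p : G p -> G (a *: p) by move=> Gp; rewrite -[_ *: _]addr0; exact: Glin.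
have GD p q : G p -> G q -> G (p + q).
  by move=> Gp Gq; rewrite -[p]scale1r; exact: Glin.
pose S := [set (p.2 : R) - `|p.1 - v| | p in G].
have Sub q : G q -> ubound S (`|q.1 + v| - q.2).
  move=> Gq _ [p Gp <-].
  have := ler_normD (p.1 - v) (q.1 + v).
  rewrite addrACA addNr addr0.
  have /= := Gdom _ (GD _ _ Gp Gq); lra.
have S0 : S !=set0 by exists (0 - `|0 - v|); exists 0.
have hS : has_sup S by split => //; exists (`|0 + v| - 0); exact: (Sub 0).
pose c : R^o := sup S.
have cge q : G q -> q.2 - `|q.1 - v| <= c.
  by move=> Gq; apply: ub_le_sup; [exact: hS.2 | exists q].
have cle q : G q -> c <= `|q.1 + v| - q.2.
  by move=> Gq; apply: ge_sup => //; exact: Sub.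
pose w : X * R^o := (v, c).
exists [set p.2 + p.1 *: w | p in [set p : R * (X * R^o) | G p.2]]; last first.
  by exists c; exists (1, 0) => //=; rewrite add0r scale1r.
split; last by move=> p Gp; exists (0, p) => //=; rewrite scale0r addr0.
split.
  move=> a _ _ [[s p] /= Gp <-] [[t q] /= Gq <-].
  exists (a * s + t, a *: p + q) => /=; first exact: Glin.
  by rewrite scalerDl scalerDr scalerA addrACA.
move=> _ [[t [u r]] /= Gp <-] /=.
have normZ s (y : X) : 0 < s -> s * `|y| = `|s *: y|.
  by move=> s0; rewrite normrZ gtr0_norm.
(* Homogeneity reduces the bound on u + t v to the two families of bounds on c,
   at u / -t when t < 0 and at u / t when t > 0. *)
have [t0|t0|->] := ltgtP t 0; last by rewrite !scale0r !addr0; exact: Gdom Gp.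
- have nt : 0 < - t by rewrite oppr_gt0.
  have := cge _ (GZ (- t)^-1 _ Gp).
  rewrite -(ler_pM2l nt) mulrBr normZ// scalerBr scalerA mulrA.
  by rewrite divff ?gt_eqF// mul1r scale1r scaleNr opprK /GRing.scale/=; lra.
- have := cle _ (GZ t^-1 _ Gp).
  rewrite -(ler_pM2l t0) mulrBr normZ// scalerDr scalerA mulrA.
  by rewrite divff ?gt_eqF// mul1r scale1r /GRing.scale/=; lra.
Qed.

(** Zorn's lemma extends the functional t x |-> t |x|, defined on the line through
    x, to a maximal dominated one, which by the previous lemma is defined
    everywhere. *)
Lemma norming_functional (x : X) :
  exists2 f : dual X, f x = `|x| & forall u, `|f u| <= `|u|.
Proof.
pose L : set (X * R^o) := [set (t *: x, t * `|x|) | t in [set: R]].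
have Ldom : dominated_graph L.
  split=> [a _ _ [s _ <-] [t _ <-]|_ [t _ <-]] /=.
    exists (a * s + t) => //; congr pair; first by rewrite /= scalerDl -scalerA.
    by rewrite /= mulrDl -mulrA.
  by rewrite normrZ ler_wpM2r// ler_norm.
(* Zorn is applied to the part added to L, so that the union of the empty chain
   is also admissible. *)
have [|A [Adom Amax]] :=
    @Zorn_bigcup (X * R^o) (fun G => dominated_graph (L `|` G)).
  move=> F FP Ftot.
  have mem p : (L `|` \bigcup_(G in F) G) p ->
      L p \/ exists2 G, F G & (L `|` G) p.
    by case=> [|[G FG Gp]]; [left | right; exists G => //; right].
  have sub G : F G -> L `|` G `<=` L `|` \bigcup_(G in F) G.
    by move=> FG; apply: setUS => p Gp; exists G.
  split=> [a p q /mem[Lp|[G FG Gp]] /mem[Lq|[H FH Hq]]|p /mem[Lp|[G FG Gp]]].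
  - by left; exact: Ldom.1.
  - by apply: (sub _ FH); apply: (FP _ FH).1 => //; left.
  - by apply: (sub _ FG); apply: (FP _ FG).1 => //; left.
  - have [GH|HG] := Ftot _ _ FG FH.
      by apply: (sub _ FH); apply: (FP _ FH).1 => //; exact: setUS GH _ Gp.
    by apply: (sub _ FG); apply: (FP _ FG).1 => //; exact: setUS HG _ Hq.
  - exact: Ldom.2.
  - exact: (FP _ FG).2.
have [Blin Bdom] := Adom.
set B := L `|` A in Adom Blin Bdom.
have B0 : B 0 by left; exists 0 => //; rewrite scale0r mul0r.
have Btot v : exists r, B (v, r).
  have [G [Gdom BG] [c Gc]] := dominated_graph_extend v B0 Adom.
  exists c; right; apply: contrapT => Ac; apply: (Amax G).
    split; last by move=> /(_ _ Gc).
    by move=> p Ap; apply: BG; right.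
  by rewrite (_ : L `|` G = G)//; apply/setUidPr => p Lp; apply: BG; left.
have Buniq v r s : B (v, r) -> B (v, s) -> r = s.
  have le t t' : B (v, t) -> B (v, t') -> t <= t'.
    move=> Bt Bt'; have := Bdom _ (Blin (-1) _ _ Bt' Bt) => /=.
    by rewrite !scaleN1r addNr normr0; lra.
  by move=> Br Bs; apply/eqP; rewrite eq_le !le.
have [h Bh] := choice Btot.
have hlin : linear (h : X -> R^o).
  by move=> a u v; apply: Buniq (Bh _) _; exact: (Blin a _ _ (Bh u) (Bh v)).
have hN u : h (- u) = - h u.
  have := hlin (-1) u 0; have := hlin 1 0 0.
  by rewrite scale1r !addr0 !scaleN1r/= scale1r; lra.
have hle u : `|h u| <= `|u|.
  rewrite ler_norml; have /= := Bdom _ (Bh u); have /= := Bdom _ (Bh (- u)).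
  by rewrite hN normrN; lra.
pose hL := GRing.isLinear.Build _ _ _ _ h hlin.
pose hl : {linear X -> R^o} := HB.pack h hL.
have hcont : continuous (h : X -> R^o).
  apply: (@bounded_linear_continuous _ _ _ hl); apply/linear_boundedP.
  by exists 1; split=> // r r1 u; rewrite (le_trans (hle u))// ler_peMl// ltW.
have hP : (h : X -> R^o) \in @dual_pred R X by rewrite inE.
exists (Dual hP) => //=.
by apply: Buniq (Bh x) _; left; exists 1 => //; rewrite scale1r mul1r.
Qed.
End HahnBanach.

(** * Linear spans and rational combinations *)

Lemma countable_enum (T : Type) (t : T) (G : set T) :
  countable G -> exists b : nat -> T, G `<=` range b.
Proof.
move=> /countable_injP[f finj].
have /choice[b bP] : forall n, exists u, forall w, G w -> f w = n -> u = w.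
  move=> n; have [[w Gw <-]|no] := pselect (exists2 w, G w & f w = n).
    by exists w => w' Gw' ww'; apply: finj; rewrite ?inE.
  by exists t => w Gw fw; exfalso; apply: no; exists w.
by exists b => w Gw; exists (f w) => //; exact: bP.
Qed.

Section RationalSpan.
Context {R : realType} {V : lmodType R}.
Implicit Types (A B : set V) (b : nat -> V).

Lemma lin_spanS A B : A `<=` B -> lin_span A `<=` lin_span B.
Proof.
move=> AB _ [n [c [a [Aa ->]]]]; exists n, c, a; split=> // i; exact: AB.
Qed.

Lemma sub_lin_span A : A `<=` lin_span A.
Proof.
move=> a Aa; exists 1, (fun=> 1), (fun=> a); split=> //.
by rewrite big_ord1 scale1r.
Qed.

Lemma lin_span_linear A k u v :
  lin_span A u -> lin_span A v -> lin_span A (k *: u + v).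
Proof.
move=> [n [c [a [Aa ->]]]] [m [d [b [Ab ->]]]]; exists (n + m)%N.
exists (fun i : 'I_(n + m) =>
  match fintype.split i with inl j => k * c j | inr j => d j end).
exists (fun i : 'I_(n + m) =>
  match fintype.split i with inl j => a j | inr j => b j end).
split=> [i|]; first by case: fintype.split.
rewrite big_split_ord scaler_sumr; congr (_ + _); apply: eq_bigr => i _.
  by rewrite -[lshift _ _]/(unsplit (inl i)) unsplitK scalerA.
by rewrite -[rshift _ _]/(unsplit (inr i)) unsplitK.
Qed.

Lemma lin_span0 A : lin_span A 0.
Proof.
by exists 0%N, (fun=> 0), (fun=> 0); split=> [[]//|]; rewrite big_ord0.
Qed.

(** Indexing by [seq (rat * nat)], a countable type, is what makes the set of
    these combinations countable. *)
Definition rat_comb b (s : seq (rat * nat)) : V :=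
  \sum_(p <- s) ratr p.1 *: b p.2.

(** Stated for a seminorm N, to serve both the norm of X and the seminorms that
    define the w*-topology. *)
Lemma rat_comb_approx b (N : V -> R) v e :
    (forall u w, N (u + w) <= N u + N w) ->
    (forall k u, N (k *: u) = `|k| * N u) ->
  lin_span (range b) v -> 0 < e -> exists s, N (v - rat_comb b s) < e.
Proof.
move=> ND NZ; have N0 : N 0 = 0 by rewrite -(scale0r 0) NZ normr0 mul0r.
have N_ge0 u : 0 <= N u.
  by have := ND u (-1 *: u); rewrite NZ scaleN1r subrr N0 normrN1 mul1r; lra.
move=> [n [c [a [ab ->]]]]; elim: n c a ab e => [|n IH] c a ab e e0.
  by exists [::]; rewrite big_ord0 /rat_comb big_nil subrr N0.
have e20 : 0 < e / 2 by rewrite divr_gt0.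
have [s sP] := IH (c \o widen_ord (leqnSn n)) (a \o widen_ord (leqnSn n))
                  (fun i => ab _) _ e20.
have [k _ bk] := ab ord_max.
(* The 1 keeps d meaningful when N vanishes at the last vector. *)
pose d := e / 2 / (N (a ord_max) + 1).
have Na : 0 < N (a ord_max) + 1 by rewrite ltr_wpDl.
have d0 : 0 < d by rewrite divr_gt0.
have [q qP] : exists q : rat, `|c ord_max - ratr q| < d.
  have : c ord_max - d < c ord_max + d by lra.
  move=> /rat_in_itvoo[q]; rewrite in_itv/= => /andP[q1 q2]; exists q.
  by rewrite ltr_norml; lra.
exists (rcons s (q, k)).
rewrite /rat_comb big_rcons/= bk big_ord_recr/= opprD addrACA -scalerBl.
rewrite (le_lt_trans (ND _ _))// NZ (splitr e) ltrD//.
rewrite (le_lt_trans (y := `|c ord_max - ratr q| * (N (a ord_max) + 1)))//.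
  by rewrite ler_wpM2l//; lra.
by rewrite -ltr_pdivlMr.
Qed.

End RationalSpan.

(** * The weak-star topology *)

Section WeakStar.
Context {R : realType} (X : normedModType R).
Implicit Types (f g : dual X) (x : X) (S : set (dual X)).

Lemma dualP k f x y : f (k *: x + y) = k * f x + f y.
Proof. by have := dual_funP f; rewrite inE => -[+ _]; exact. Qed.

Lemma dual0 f : f 0 = 0.
Proof. by have := dualP 1 f 0 0; rewrite scale1r addr0; lra. Qed.

Lemma dual_linE k f g x : (k *: f + g) x = k * f x + g x.
Proof. by []. Qed.

Lemma dual_scaleE k f x : (k *: f) x = k * f x.
Proof. by []. Qed.

Lemma dual_subE f g x : (f - g) x = f x - g x.
Proof. by []. Qed.

Lemma dual_continuous f : continuous f.
Proof. by have := dual_funP f; rewrite inE => -[]. Qed.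

Lemma eval_continuous x : continuous (fun f : dual X => f x : R).
Proof.
have c1 : continuous (@dual_fun R X : dual X -> {ptws X -> R}).
  exact: initial_continuous.
have c2 : continuous (fun h : {ptws X -> R} => h x).
  exact: (@proj_continuous _ (fun=> R) x).
move=> f; exact: (@continuous_comp _ {ptws X -> R} _ _ _ _ (c1 f) (c2 _)).
Qed.

(** These seminorms generate the w*-topology; as the set of points is a list,
    intersecting two basic neighborhoods concatenates the lists. *)
Definition weak_seminorm (s : seq X) f : R := \sum_(x <- s) `|f x|.

Lemma weak_seminormD s f g :
  weak_seminorm s (f + g) <= weak_seminorm s f + weak_seminorm s g.
Proof. by rewrite -big_split; apply: ler_sum => x _; exact: ler_normD. Qed.

Lemma weak_seminormZ s k f : weak_seminorm s (k *: f) = `|k| * weak_seminorm s f.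
Proof. by rewrite mulr_sumr; apply: eq_bigr => x _; rewrite -normrM. Qed.

(** The seminorm balls around f generate a filter that converges to f pointwise,
    so it converges in the w*-topology and refines the neighborhoods of f. *)
Lemma nbhs_weak_seminorm f (A : set (dual X)) : nbhs f A ->
  exists s, exists2 e, 0 < e & forall g, weak_seminorm s (f - g) < e -> A g.
Proof.
pose D := [set p : seq X * R | 0 < p.2].
pose F := filter_from D (fun p => [set g | weak_seminorm p.1 (f - g) < p.2]).
have FF : Filter F.
  apply: filter_from_filter => [|[s d] [t e] /= d0 e0].
    by exists ([::], 1); rewrite /D/=.
  exists (s ++ t, Num.min d e); first by rewrite /D/= lt_min d0.
  move=> g /=; rewrite /weak_seminorm big_cat/= lt_min => /andP[sd te].
  split; [apply: le_lt_trans sd|apply: le_lt_trans te].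
    by rewrite lerDl sumr_ge0.
  by rewrite lerDr sumr_ge0.
have Ff : {ptws, (@dual_fun R X @ F) --> (f : X -> R)}.
  apply/pointwise_cvgP => x; apply/cvgrPdist_lt => e e0.
  by exists ([:: x], e) => // g /=; rewrite /weak_seminorm big_seq1.
rewrite nbhsE => -[B [Bo Bf] BA].
have [C Co CB] := Bo.
have /Ff : nbhs (@dual_fun R X f : {ptws X -> R}) C.
  by apply: open_nbhs_nbhs; split=> //; rewrite -CB in Bf.
move=> [[s e] /= e0 sub]; exists s, e => // g /sub Cg.
by apply: BA; rewrite -CB.
Qed.

(** If x <> 0, the functionals nonzero at x form a nonempty w*-open set by
    Hahn-Banach; an element of the span of F lies in it, and so does one of the
    elements of F that it combines. *)
Lemma separates_dense_span (F : set (dual X)) :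
  closure (lin_span F) = [set: dual X] -> separates F.
Proof.
move=> cF x x0; have [g gx _] := norming_functional x.
have og : nbhs g [set h : dual X | h x != 0].
  suff /(@eval_continuous x g) : nbhs (g x : R) [set r | r != 0] by [].
  by apply: open_nbhs_nbhs; split; [exact: open_neq|rewrite /= gx normr_eq0].
have : closure (lin_span F) g by rewrite cF.
move=> /(_ _ og)[_ [[n [c [a [Fa ->]]]] /= sx0]].
apply: contrapT => noF; move/eqP: sx0; apply.
rewrite (big_morph (fun h : dual X => h x) (fun g h => erefl) erefl).
apply: big1 => i _; have [aix|/eqP aix] := eqVneq (a i x) 0.
  by rewrite dual_scaleE aix mulr0.
by exfalso; apply: noF; exists (a i) => //; exact/eqP.
Qed.

(** Since x is killed by the annihilator of s in S, it lies in the span of s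
    modulo the common kernel of S, which is 0 as S separates; the conclusion is
    this membership seen through functionals. The induction removes a point y: if
    some h0 in S vanishes on the rest of s but not at y, the hypothesis passes
    from x to x - (h0 x / h0 y) y; otherwise y is redundant. *)
Lemma interpolation_kernel S (s : seq X) x f :
    (forall k g h, S g -> S h -> S (k *: g + h)) -> separates S ->
    (forall h, S h -> (forall y, y \in s -> h y = 0) -> h x = 0) ->
  (forall y, y \in s -> f y = 0) -> f x = 0.
Proof.
move=> Slin Ssep; elim: s x => [|y s IH] x xker fs.
  have [->|/Ssep[h Sh]] := eqVneq x 0; first exact: dual0.
  by rewrite xker// eqxx.
have fs' z : z \in s -> f z = 0 by move=> zs; rewrite fs// inE zs orbT.
have [[h0 [Sh0 h0s h0y]]|noh] := pselect (exists h0,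
    [/\ S h0, forall z, z \in s -> h0 z = 0 & h0 y != 0]); last first.
  apply: IH => // h Sh hs; apply: xker => // z.
  rewrite inE => /predU1P[->|/hs//].
  by apply: contrapT => /eqP hy; apply: noh; exists h.
pose k : R := h0 x / h0 y.
have : f (- k *: y + x) = 0.
  apply: IH => // h Sh hs; rewrite dualP.
  have := xker (- (h y / h0 y) *: h0 + h).
  rewrite dual_linE => /(_ (Slin _ _ _ Sh0 Sh)) hx.
  rewrite -[RHS]hx; first by rewrite /k; ring.
  move=> z; rewrite inE dual_linE => /predU1P[->|zs].
    by rewrite mulNr divfK// addNr.
  by rewrite (h0s z)// (hs z)// mulr0 addr0.
by rewrite dualP fs ?mem_head// mulr0 add0r.
Qed.

(** When every element of S that vanishes on s also vanishes at the next point y,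
    no correction at y is possible, but none is needed: the kernel lemma applied
    to f - g gives g y = f y. *)
Lemma interpolation S (s : seq X) f :
    (forall k g h, S g -> S h -> S (k *: g + h)) -> S 0 -> separates S ->
  exists2 g, S g & forall x, x \in s -> g x = f x.
Proof.
move=> Slin S0 Ssep; elim: s => [|y s [g Sg gs]]; first by exists 0.
have [[h [Sh hs hy]]|noh] := pselect (exists h,
    [/\ S h, forall z, z \in s -> h z = 0 & h y != 0]).
  exists ((f y - g y) / h y *: h + g); first exact: Slin.
  move=> x; rewrite inE dual_linE => /predU1P[->|xs].
    by rewrite divfK// subrK.
  by rewrite (hs x)// mulr0 add0r gs.
exists g => // x; rewrite inE => /predU1P[->|/gs//].
apply/eqP; rewrite eq_sym -subr_eq0 -dual_subE; apply/eqP.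
apply: (@interpolation_kernel S s) => // [h Sh hs|z zs].
  by apply: contrapT => /eqP hy; apply: noh; exists h.
by rewrite dual_subE gs// subrr.
Qed.

(** The span of a countable separating set interpolates any f on the finite set s
    of a basic w*-neighborhood of f; its rational combinations come as close as
    required. *)
Lemma CSP_weak_dual_separable : CSP X ->
  exists2 E : set (dual X), countable E & dense E.
Proof.
move=> /(_ setT)[x x0|G [_ Gc Gsep]].
  by have [f fx _] := norming_functional x; exists f => //; rewrite fx normr_eq0.
have [b Gb] := countable_enum 0 Gc.
exists (range (rat_comb b)).
  exact: sub_countable (card_image_le _ _) (countableP _).
move=> O [f Of] oO.
have [s [e e0 sub]] := nbhs_weak_seminorm (open_nbhs_nbhs (conj oO Of)).
have [||x /Gsep[h Gh hx]|g Sg gf] := @interpolation (lin_span (range b)) s f.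
- by move=> *; exact: lin_span_linear.
- exact: lin_span0.
- by exists h => //; apply: sub_lin_span; exact: Gb.
have [t gt] := rat_comb_approx (weak_seminormD s) (weak_seminormZ s) Sg e0.
exists (rat_comb b t); split; last by exists t.
apply: sub; rewrite (le_lt_trans _ gt)// le_eqVlt; apply/orP; left; apply/eqP.
by apply: eq_big_seq => x xs; rewrite !dual_subE gf.
Qed.

(** Evaluation at x is continuous and unbounded, so the values at x of a dense set
    are unbounded. *)
Lemma weak_dual_dense_infinite x (E : set (dual X)) :
  x != 0 -> dense E -> infinite_set E.
Proof.
move=> x0 dE /(finite_image (fun f => f x : R)) /finite_compact/compact_bounded.
move=> /pinfty_ex_gt0[M M0 EM].
have [f fx _] := norming_functional x.
have := dE ((fun f => f x : R) @^-1` [set r | M < r]).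
case.
- exists ((M + 1) / `|x| *: f).
  suff : M < (M + 1) / `|x| * f x by [].
  by rewrite fx divfK ?normr_eq0// ltrDl.
- by apply: open_comp => [? _|]; [exact: eval_continuous|exact: open_gt].
move=> g [/= Mg Eg]; have := EM (g x).
rewrite /= => /(_ (imageP _ Eg)); have := ler_norm (g x); lra.
Qed.

End WeakStar.

(** * Separability and the countable separation property *)

Section Separability.
Context {R : realType} (X : normedModType R).

(** The Lindelof argument: for each of the countably many balls on which some
    element of F has no zero, keep one such element. *)
Lemma separable_CSP : separable X -> CSP X.
Proof.
move=> [D Dc dD] F Fsep; have [b Db] := countable_enum 0 Dc.
pose good (p : nat * nat) (f : dual X) :=
  F f /\ ball (b p.1) p.2.+1%:R^-1 `<=` [set y | f y != 0].
have /choice[phi phiP] : forall p, exists f, (exists g, good p g) -> good p f.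
  by move=> p; have [[g pg]|no] := pselect (exists g, good p g);
    [exists g|exists 0].
exists (phi @` [set p | exists g, good p g]); split.
- by move=> _ [p /phiP[Ff _] <-].
- exact: sub_countable (card_image_le _ _) (countableP _).
move=> x /Fsep[f Ff fx].
have : nbhs x [set y | f y != 0].
  suff /(@dual_continuous _ _ f x) : nbhs (f x : R) [set r | r != 0] by [].
  by apply: open_nbhs_nbhs; split=> //; exact: open_neq.
move=> /nbhs_ballP[e e0 fe].
have /ltr_add_invr[k] : 0 < e / 2 by rewrite divr_gt0.
rewrite add0r => ke.
have [||d [xd /Db[n _ bn]]] := dD (ball x k.+1%:R^-1).
- by exists x; apply: ballxx.
- by apply: ball_open.
have gp : exists g, good (n, k) g.
  exists f; split=> // y /= ny; apply: fe.
  rewrite (splitr e).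
  apply: ball_triangle (le_ball (ltW ke) _) (le_ball (ltW ke) ny).
  by rewrite bn.
exists (phi (n, k)); first by exists (n, k).
by apply: (phiP _ gp).2; rewrite /= bn; apply: ball_sym.
Qed.

Lemma separable_of_countable_span (A : set X) :
  countable A -> closure (lin_span A) = [set: X] -> separable X.
Proof.
move=> Ac cA; have [b Ab] := countable_enum 0 Ac.
exists (range (rat_comb b)).
  exact: sub_countable (card_image_le _ _) (countableP _).
move=> O [x Ox] oO.
have : closure (lin_span A) x by rewrite cA.
move=> /(_ _ (open_nbhs_nbhs (conj oO Ox)))[y [Sy Oy]].
have /nbhs_normP[e e0 Oe] := open_nbhs_nbhs (conj oO Oy).
have [t yt] := rat_comb_approx (@ler_normD _ _) (@normrZ _ _)
  (lin_spanS Ab Sy) e0.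
by exists (rat_comb b t); split; [exact: Oe|exists t].
Qed.

(** Under (a), (b) and CSP, the argument that only countably many x_a are nonzero;
    it covers condition (c) and M-bases alike. *)
Lemma CSP_countable_system_separable (I J : Type) (x : I -> X) (f : J -> dual X) :
    CSP X -> closure (lin_span (range x)) = [set: X] ->
    closure (lin_span (range f)) = [set: dual X] ->
    (forall b, countable [set a | f b (x a) != 0]) ->
  separable X.
Proof.
move=> cspX cx cf cfx.
have [G [Gf Gc Gsep]] := cspX _ (separates_dense_span cf).
pose A := [set a | x a != 0].
have Ac : countable A.
  apply: (@sub_countable _ _ _ (\bigcup_(g in G) [set a | g (x a) != 0])).
    by apply: subset_card_le => a /Gsep[g Gg gxa]; exists g.
  by apply: bigcup_countable => // _ /Gf[b _ <-].
apply: (@separable_of_countable_span (x @` A `|` [set 0])).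
  rewrite -bigcup2E; apply: bigcup_countable => // -[|[|n]] _ /=.
  - exact: sub_countable (card_image_le _ _) Ac.
  - exact: finite_set_countable.
  - exact: countable0.
apply/seteqP; split=> // y _; have : closure (lin_span (range x)) y by rewrite cx.
apply: closureS; apply: lin_spanS => _ [a _ <-].
by have [->|xa0] := eqVneq (x a) 0; [right | left; exists a].
Qed.

Lemma CSP_card_le_dens (I : Type) (A : set I) :
  CSP X -> card_le_dens A (dual X) -> countable A.
Proof.
move=> /CSP_weak_dual_separable[E Ec dE] [D [_ Dmin] AD].
exact: sub_countable AD (sub_countable (Dmin _ dE) Ec).
Qed.

(** Every dense set is infinite when X is nonzero, so that any countable one has
    the least cardinality. *)
Lemma CSP_card_le_dens_countable (I : Type) (A : set I) (x : X) :
  CSP X -> x != 0 -> countable A -> card_le_dens A (dual X).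
Proof.
move=> /CSP_weak_dual_separable[D Dc dD] x0 Ac.
exists D.
  split=> // E /(weak_dual_dense_infinite x0)/infiniteP.
  exact: card_le_trans Dc.
have /infiniteP := weak_dual_dense_infinite x0 dD.
exact: card_le_trans Ac.
Qed.

End Separability.

(** * The characterization of separability *)

Theorem proposition2p7 (R : realType) (X : completeNormedModType R) :
  (separable X <->
     CSP X /\
     exists (I J : Type) (x : I -> X) (f : J -> dual X),
       [/\ closure (lin_span (range x)) = [set: X],
           closure (lin_span (range f)) = [set: dual X] &
           forall b : J, card_le_dens [set a : I | f b (x a) != 0] (dual X)])
  /\
  (CSP X ->
     (exists (I : Type) (x : I -> X) (xs : I -> dual X), M_basis x xs) ->
     separable X).
Proof.
split; first split.
- move=> sX; have cspX := separable_CSP sX; split=> //.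
  have [D Dc dD] := sX; have [b Db] := countable_enum 0 Dc.
  have cb : closure (lin_span (range b)) = [set: X].
    apply/seteqP; split=> // y _ B; rewrite nbhsE => -[U [oU Uy] UB].
    have [z [Uz /Db bz]] := dD U (ex_intro _ y Uy) oU.
    by exists z; split; [exact: sub_lin_span | exact: UB].
  have [[x x0]|X0] := pselect (exists x : X, x != 0).
    exists nat, (dual X), b, id; split=> // [|f].
      apply/seteqP; split=> // f _; apply: subset_closure.
      by apply: sub_lin_span; exists f.
    exact: CSP_card_le_dens_countable x0 _.
  have dual_trivial (f : dual X) : f = 0.
    apply/val_inj/funext => x /=.
    have -> : x = 0 by apply: contrapT => /eqP ?; apply: X0; exists x.
    exact: dual0.
  exists nat, False, b, (fun i : False => match i with end).
  split=> //.
  apply/seteqP; split=> // f _; apply: subset_closure.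
  by rewrite (dual_trivial f); exact: lin_span0.
- move=> [cspX [I [J [x [f [cx cf fx]]]]]].
  apply: (CSP_countable_system_separable cspX cx cf) => b.
  exact: CSP_card_le_dens (fx b).
move=> cspX [I [x [xs [xxs cx cxs]]]].
apply: (CSP_countable_system_separable cspX cx cxs) => a.
apply: (@sub_countable _ _ _ [set a]); last exact: finite_set_countable.
apply: subset_card_le => b; rewrite /= xxs.
by case: asboolP => // _; rewrite eqxx.
Qed.
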